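(* Let $M_h$ be a quasi-optimal method as described in the context, with consistency measure $\delta_h$. Suppose that the following three assumptions hold. (H1) $\mathcal A_h:V_h\to V$ is a bounded linear operator with $\mathcal A_h w_h=w_h$ for all $w_h\in V\cap V_h$. (Then there is $C_{\mathrm{av}}>0$ with $C_{\mathrm{av}}\|v_h-\mathcal A_hv_h\|\le\|v_h-\Pi_Vv_h\|$ for all $v_h\in V_h$; this is the constant arising from (H1).) (H2) There are a finite index set $\mathcal Z$, functions $(\Phi_z)_{z\in\mathcal Z}$, subspaces $(V_z)_{z\in\mathcal Z}$ of $V$, a bounded linear operator $\mathcal I_h:V\to V_h$ and constants $C_{\mathrm{loc}},C_{\mathrm{col}}>0$ such that: (i) for all $z\in\mathcal Z$ and $v\in V$ one has $\sum_{z\in\mathcal Z}v\Phi_z=v$ with $v\Phi_z\in V_z$; (ii) $\|\sum_{z\in\mathcal Z}v_z\|^2\le C_{\mathrm{col}}^2\sum_{z\in\mathcal Z}\|v_z\|^2$ for all $v_z\in V_z$, $z\in\mathcal Z$; (iii) $\sum_{z\in\mathcal Z}\|(v-\mathcal E_h\mathcal I_hv)\Phi_z\|^2\le C_{\mathrm{loc}}^2\|v\|^2$ for all $v\in V$. (H3) There are linear spaces $(S_z)_{z\in\mathcal Z}$, $(D_z)_{z\in\mathcal Z}$ and constants $C_L,C_{NL}>0$ such that for all $z\in\mathcal Z$: (i) $S_z\subseteq V$ and $D_z\subseteq(\widetilde V_z)'$, where $\widetilde V_z:=V_z+S_z$; (ii) $(\widetilde Av_h)_{|\widetilde V_z}\in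 D_z$ for all $v_h\in V_h$; (iii) $\dim S_z\le\dim D_z<\infty$; (iv) $\|\chi\|_{V_z'}\le C_L\|\chi\|_{S_z'}$ for all $\chi\in D_z$; and (v) $\sum_{z\in\mathcal Z}\|g\|_{S_z'}^2\le C_{NL}^2\sum_{z\in\mathcal Z}\|g\|_{V_z'}^2$ for all $g\in V'$. For $z\in\mathcal Z$ let $\mathcal P_z:(\widetilde V_z)'\to D_z$ be the linear projection defined by $\langle\mathcal P_zg,s\rangle=\langle g,s\rangle$ for all $s\in S_z$ (well defined under (H3)). Given tuning constants $C_1,C_2>0$, set $$\mathrm{est}_h^2:=(1+C_1^2\delta_h^2)\,\mathrm{ncf}_h^2+C_2^2(\eta_h^2+\mathrm{osc}_h^2),$$ $$\mathrm{ncf}_h^2:=\|u_h-\mathcal A_hu_h\|^2,\qquad \eta_h^2:=\sum_{z\in\mathcal Z}\|\mathcal P_zf-\widetilde Au_h\|_{V_z'}^2,\qquad \mathrm{osc}_h^2:=\sum_{z\in\mathcal Z}\|f-\mathcal P_zf\|_{V_z'}^2 .$$ Then this estimator quantifies the error by $$\underline C\,\mathrm{est}_h\le\|u-u_h\|\le\overline C\,\mathrm{est}_h,$$ where the equivalence constants $\underline C,\overline C$ depend only on the norm $|||A_h|||$ of the discrete operator $A_h$, the constants arising from the assumptions (H1), (H2) and (H3), and the tuning constants $C_1,C_2$.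
   Context: $V$ is a real Hilbert space (in applications, of functions over some domain), with scalar product $a(\cdot,\cdot)$ and norm $\|\cdot\|=\sqrt{a(\cdot,\cdot)}$. $V_h$ is a finite-dimensional linear space, not necessarily contained in $V$, and $\widetilde V:=V+V_h$. It is assumed that $a$ extends to a scalar product $\widetilde a$ on $\widetilde V$; the induced norm is again denoted $\|\cdot\|$. $\widetilde A:\widetilde V\to\widetilde V'$ is $\widetilde A\tilde v:=\widetilde a(\tilde v,\cdot)$, and $\Pi_V:\widetilde V\to V$ is the $\widetilde a$-orthogonal projection onto $V$. For a subspace $X\subseteq\widetilde V$ and a functional $g$ defined on (a superspace of) $X$, $\|g\|_{X'}:=\sup\{\langle g,x\rangle: x\in X,\|x\|\le1\}$; functionals are restricted to the relevant subspace without notation, in particular $\mathcal P_zg:=\mathcal P_z(g_{|\widetilde V_z})$ for $g\in V'$. $|||\cdot|||$ denotes the operator norm. For $f\in V'$ the exact solution is the unique $u\in V$ with $a(u,v)=\langle f,v\rangle$ for all $v\in V$. Let $a_h:V_h\times V_h\to\mathbb R$ be a nondegenerate bilinear form and $\mathcal E_h:V_h\to V$ a linear (smoothing) operator. The discrete solution is the unique $u_h\in V_h$ with $a_h(u_h,v_h)=\langle f,\mathcal E_hv_h\rangle$ for all $v_h\in V_h$, and $M_h:V'\to V_h$, $f\mapsto u_h$, is the method. $A_h:V_h\to V_h'$ is $A_hv_h:=a_h(v_h,\cdot)$ and $A_h^*v_h:=a_h(\cdot,v_h)$. $M_h$ is quasi-optimal if there is $C_{\mathrm{qo}}\ge1$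 with $\|u-u_h\|\le C_{\mathrm{qo}}\inf_{v_h\in V_h}\|u-v_h\|$ for all $f\in V'$. It is known that this is equivalent to the existence of a constant $\delta_h\ge0$, called the consistency measure of the method, such that $$a_h(w_h,v_h)-a(\Pi_Vw_h,\mathcal E_hv_h)\le\delta_h\,\|A_h^*v_h\|_{V_h'}\,\|w_h-\Pi_Vw_h\|\qquad\text{for all }v_h,w_h\in V_h.$$
   Formalization: The lower equivalence constant may also depend on the consistency measure δ_h (the upper one may not), since a lower constant independent of δ_h is impossible in general; the norm of I_h is counted among the constants arising from (H2). *)

(* Defs.v *)
From HB Require Import structures.
From mathcomp Require Import all_boot all_order all_algebra.
From mathcomp Require Import all_classical all_reals all_analysis.

Set Implicit Arguments.
Unset Strict Implicit.
Unset Printing Implicit Defensive.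

Import Order.TTheory GRing.Theory Num.Theory.
Import numFieldNormedType.Exports.

Local Open Scope classical_set_scope.
Local Open Scope ring_scope.

Definition has_dim (R : realType) (E : lmodType R) (X : set E) (n : nat) : Prop :=
  exists e : 'I_n -> E,
    (forall c : 'I_n -> R, \sum_(i < n) c i *: e i = 0 -> forall i, c i = 0) /\
    X = range (fun c : 'I_n -> R => \sum_(i < n) c i *: e i).

(* The set is nonempty when [X] is a linear space, and it is bounded above when
   [g] is bounded on [X]; on unbounded functionals the real-valued [sup] takes
   the default value 0. *)
Definition dual_norm (R : realType) (T : Type) (nu : T -> R) (X : set T)
    (g : T -> R) : R :=
  sup [set g x | x in [set x | X x /\ nu x <= 1]].

Definition op_norm (R : realType) (T U : Type) (nu : T -> R) (mu : U -> R)
    (L : T -> U) : R :=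
  sup [set mu (L x) | x in [set x | nu x <= 1]].

Definition bounded_map (R : realType) (T U : Type) (nu : T -> R) (mu : U -> R)
    (L : T -> U) : Prop :=
  exists M : R, forall x, mu (L x) <= M * nu x.

(* The spaces V and V_h are separate types, identified with subspaces of
   Vt = V + V_h through the linear injections [jV] and [jh]. *)
Definition nonconforming_pair (R : realType) (V : completeNormedModType R)
    (Vh : vectType R) (Vt : normedModType R)
    (a : {dot V for idfun}) (at_ : {dot Vt for idfun})
    (jV : {linear V -> Vt}) (jh : {linear Vh -> Vt}) : Prop :=
  [/\ forall v : V, `|v| = Num.sqrt (a v v),
      forall w : Vt, `|w| = Num.sqrt (at_ w w),
      forall v v' : V, at_ (jV v) (jV v') = a v v',
      injective jh
    & forall w : Vt, exists (v : V) (vh : Vh), w = jV v + jh vh].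

Definition orthogonal_projection (R : realType) (V : completeNormedModType R)
    (Vt : normedModType R) (at_ : {dot Vt for idfun}) (jV : {linear V -> Vt})
    (PiV : Vt -> V) : Prop :=
  forall (w : Vt) (v : V), at_ (w - jV (PiV w)) (jV v) = 0.

Definition exact_solution (R : realType) (V : completeNormedModType R)
    (a : {dot V for idfun}) (f : {scalar V}) (u : V) : Prop :=
  forall v, a u v = f v.

Definition nondegenerate_form (R : realType) (Vh : vectType R)
    (ah : {biscalar Vh}) : Prop :=
  (forall w, (forall v, ah w v = 0) -> w = 0) /\
  (forall v, (forall w, ah w v = 0) -> v = 0).

Definition discrete_solution (R : realType) (V : completeNormedModType R)
    (Vh : vectType R) (ah : {biscalar Vh}) (Eh : {linear Vh -> V})
    (f : {scalar V}) (uh : Vh) : Prop :=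
  forall vh, ah uh vh = f (Eh vh).

Definition norm_h (R : realType) (Vh : vectType R) (Vt : normedModType R)
    (jh : {linear Vh -> Vt}) (vh : Vh) : R := `|jh vh|.

Definition dual_norm_h (R : realType) (Vh : vectType R) (Vt : normedModType R)
    (jh : {linear Vh -> Vt}) (g : Vh -> R) : R :=
  dual_norm (norm_h jh) [set: Vh] g.

(* ||| A_h ||| for A_h : V_h -> V_h', w |-> a_h(w, .) *)
Definition norm_Ah (R : realType) (Vh : vectType R) (Vt : normedModType R)
    (jh : {linear Vh -> Vt}) (ah : {biscalar Vh}) : R :=
  op_norm (norm_h jh) (dual_norm_h jh) (fun w v : Vh => ah w v : R).

Definition quasi_optimal (R : realType) (V : completeNormedModType R)
    (Vh : vectType R) (Vt : normedModType R) (a : {dot V for idfun})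
    (jV : {linear V -> Vt}) (jh : {linear Vh -> Vt})
    (ah : {biscalar Vh}) (Eh : {linear Vh -> V}) : Prop :=
  exists2 Cqo : R, 1 <= Cqo &
    forall (f : {scalar V}) (u : V) (uh : Vh),
      continuous (f : V -> R) ->
      exact_solution a f u -> discrete_solution ah Eh f uh ->
      `|jV u - jh uh| <= Cqo * inf (range (fun vh : Vh => `|jV u - jh vh|)).

Definition consistency_measure (R : realType) (V : completeNormedModType R)
    (Vh : vectType R) (Vt : normedModType R) (a : {dot V for idfun})
    (jV : {linear V -> Vt}) (jh : {linear Vh -> Vt}) (PiV : Vt -> V)
    (ah : {biscalar Vh}) (Eh : {linear Vh -> V}) (delta : R) : Prop :=
  0 <= delta /\
  forall vh wh : Vh,
    ah wh vh - a (PiV (jh wh)) (Eh vh) <=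
    delta * dual_norm_h jh (fun x => ah x vh) * `|jh wh - jV (PiV (jh wh))|.

Definition hyp1 (R : realType) (V : completeNormedModType R) (Vh : vectType R)
    (Vt : normedModType R) (jV : {linear V -> Vt}) (jh : {linear Vh -> Vt})
    (Ah : {linear Vh -> V}) : Prop :=
  bounded_map (norm_h jh) (fun v : V => `|v|) Ah /\
  forall (wh : Vh) (v : V), jh wh = jV v -> Ah wh = v.

Definition av_constant (R : realType) (V : completeNormedModType R)
    (Vh : vectType R) (Vt : normedModType R) (jV : {linear V -> Vt})
    (jh : {linear Vh -> Vt}) (PiV : Vt -> V) (Ah : {linear Vh -> V})
    (Cav : R) : Prop :=
  0 < Cav /\
  forall vh : Vh,
    Cav * `|jh vh - jV (Ah vh)| <= `|jh vh - jV (PiV (jh vh))|.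

(* [mulPhi z] is the linear operator v |-> v Phi_z of multiplication by the
   function Phi_z. *)
Definition hyp2 (R : realType) (V : completeNormedModType R) (Vh : vectType R)
    (Vt : normedModType R) (jh : {linear Vh -> Vt}) (Eh : {linear Vh -> V})
    (Z : finType) (mulPhi : Z -> {linear V -> V}) (Vz : Z -> set V)
    (Ih : {linear V -> Vh}) (Cloc Ccol : R) : Prop :=
  [/\ forall z, submod_closed [in Vz z],
      bounded_map (fun v : V => `|v|) (norm_h jh) Ih,
      0 < Cloc /\ 0 < Ccol,
      forall v : V,
        \sum_(z : Z) mulPhi z v = v /\ (forall z, Vz z (mulPhi z v))
    & (forall v : Z -> V, (forall z, Vz z (v z)) ->
         `|\sum_(z : Z) v z| ^+ 2 <= Ccol ^+ 2 * \sum_(z : Z) `|v z| ^+ 2) /\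
      (forall v : V,
         \sum_(z : Z) `|mulPhi z (v - Eh (Ih v))| ^+ 2 <= Cloc ^+ 2 * `|v| ^+ 2)].

Definition sum_space (R : realType) (V : normedModType R) (X Y : set V) : set V :=
  [set x + y | x in X & y in Y].

(* The dual of a subspace [Y] of [V], as functions on the subtype [Y]. *)
Definition dual_space (R : realType) (V : normedModType R) (Y : set V) :
    set (Y -> R^o) :=
  [set chi |
    (forall (c : R) (x y s : Y),
       \val s = c *: \val x + \val y -> chi s = c * chi x + chi y) /\
    (exists M : R, forall x : Y, `|chi x| <= M * `|\val x|)].

(* The norm in X' of a functional defined on the superspace [Y] of [X]. *)
Definition loc_norm (R : realType) (V : normedModType R) (X Y : set V)
    (chi : Y -> R^o) : R :=
  dual_norm (fun x : Y => `|\val x|) [set x : Y | X (\val x)] chi.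

(* (At v_h) restricted to the subspace [Y] of V *)
Definition res_At (R : realType) (V : completeNormedModType R)
    (Vh : vectType R) (Vt : normedModType R) (at_ : {dot Vt for idfun})
    (jV : {linear V -> Vt}) (jh : {linear Vh -> Vt}) {Y : set V} (vh : Vh) :
    Y -> R^o :=
  sigL Y (fun v => at_ (jh vh) (jV v) : R^o).

Definition hyp3 (R : realType) (V : completeNormedModType R) (Vh : vectType R)
    (Vt : normedModType R) (at_ : {dot Vt for idfun})
    (jV : {linear V -> Vt}) (jh : {linear Vh -> Vt})
    (Z : finType) (Vz Sz : Z -> set V)
    (Dz : forall z, set (sum_space (Vz z) (Sz z) -> R^o)) (CL CNL : R) : Prop :=
  [/\ 0 < CL /\ 0 < CNL,
      (forall z, submod_closed [in Sz z]) /\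
      (forall z, submod_closed [in Dz z] /\ Dz z `<=` @dual_space _ _ _),
      forall z (vh : Vh), Dz z (res_At at_ jV jh vh),
      forall z, exists m n : nat,
        [/\ has_dim (Sz z) m, has_dim (Dz z) n & (m <= n)%N]
    & (forall z chi, Dz z chi ->
         loc_norm (Vz z) chi <= CL * loc_norm (Sz z) chi) /\
      (forall g : {scalar V}, continuous (g : V -> R) ->
         \sum_(z : Z) dual_norm (fun v : V => `|v|) (Sz z) g ^+ 2 <=
         CNL ^+ 2 * \sum_(z : Z) dual_norm (fun v : V => `|v|) (Vz z) g ^+ 2)].

(* P_z g: the element of [D] that agrees with [g] on [S] *)
Definition loc_proj (R : realType) (V : normedModType R) (S Y : set V)
    (D : set (Y -> R^o)) (g : Y -> R^o) : Y -> R^o :=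
  xget 0 [set chi | D chi /\ forall s : Y, S (\val s) -> chi s = g s].

Definition ncf (R : realType) (V : completeNormedModType R) (Vh : vectType R)
    (Vt : normedModType R) (jV : {linear V -> Vt}) (jh : {linear Vh -> Vt})
    (Ah : {linear Vh -> V}) (uh : Vh) : R :=
  `|jh uh - jV (Ah uh)|.

Definition eta (R : realType) (V : completeNormedModType R) (Vh : vectType R)
    (Vt : normedModType R) (at_ : {dot Vt for idfun})
    (jV : {linear V -> Vt}) (jh : {linear Vh -> Vt})
    (Z : finType) (Vz Sz : Z -> set V)
    (Dz : forall z, set (sum_space (Vz z) (Sz z) -> R^o))
    (f : {scalar V}) (uh : Vh) : R :=
  Num.sqrt (\sum_(z : Z)
    loc_norm (Vz z)
      (loc_proj (Sz z) (Dz z) (sigL _ f) \- res_At at_ jV jh uh) ^+ 2).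

Definition osc (R : realType) (V : completeNormedModType R)
    (Z : finType) (Vz Sz : Z -> set V)
    (Dz : forall z, set (sum_space (Vz z) (Sz z) -> R^o)) (f : {scalar V}) : R :=
  Num.sqrt (\sum_(z : Z)
    loc_norm (Vz z) (sigL _ f \- loc_proj (Sz z) (Dz z) (sigL _ f)) ^+ 2).

Definition est (R : realType) (V : completeNormedModType R) (Vh : vectType R)
    (Vt : normedModType R) (at_ : {dot Vt for idfun})
    (jV : {linear V -> Vt}) (jh : {linear Vh -> Vt}) (Ah : {linear Vh -> V})
    (Z : finType) (Vz Sz : Z -> set V)
    (Dz : forall z, set (sum_space (Vz z) (Sz z) -> R^o))
    (delta C1 C2 : R) (f : {scalar V}) (uh : Vh) : R :=
  Num.sqrt ((1 + C1 ^+ 2 * delta ^+ 2) * ncf jV jh Ah uh ^+ 2 +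
            C2 ^+ 2 * (eta at_ jV jh Dz f uh ^+ 2 + osc Dz f ^+ 2)).

(* Main.v *)
Require Import Defs.
From HB Require Import structures.
From mathcomp Require Import all_boot all_order all_algebra.
From mathcomp Require Import all_classical all_reals all_analysis.
From mathcomp Require Import ring lra.

(** Write [P] for the orthogonal projection onto the conforming space [V] and
    [w = u - P u_h]. By the Pythagorean theorem the squared error is
    [|w|^2 + |u_h - P u_h|^2], a conforming and a nonconforming part.

    The nonconforming part is equivalent to [ncf_h]: [P u_h] is the best
    approximation of [u_h] in [V], hence at least as good as the average of
    [u_h], and the averaging constant gives the converse. This constant exists
    because, on a finite-dimensional space, a linear map that vanishes on the
    kernel of another one is bounded by it ([finite_dim_bounded]).

    The conforming part is the norm of the residual [a w], that is
    [v |-> f v - at_ u_h v]. For the upper bound [w] is split into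
    [w - E_h I_h w] and [E_h I_h w]. On the second piece the residual is a pure
    consistency error, controlled by [delta_h |||A_h||| |||I_h||| ncf_h |w|]
    ([consistency_residual]); the first is cut into local pieces by the
    partition of unity and costs the local dual norms of the residual
    ([residual_reliable]). Conversely, the square sum of these local dual norms
    is controlled by [|w|^2] through the bounded overlap ([residual_efficient]).

    It remains to compare each local dual norm of the residual with
    [P_z f - A u_h] and [f - P_z f], whose sum is the residual. The first
    summand lies in [D_z], where the norm over [V_z] is bounded by the norm over
    [S_z]; on [S_z] the functionals [P_z f] and [f] agree, so that only the
    residual is left ([discrete_residual_le]). The second summand follows by the
    triangle inequality ([oscillation_le]). That [P_z f] exists is linear
    algebra: restriction to [S_z] is injective on [D_z], and the dimension
    condition makes it onto ([loc_projP]). *)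

Set Implicit Arguments.
Unset Strict Implicit.
Unset Printing Implicit Defensive.

Import Order.TTheory GRing.Theory Num.Theory.
Import numFieldNormedType.Exports.

Local Open Scope classical_set_scope.
Local Open Scope ring_scope.

(* Squares come before products, since [x ^+ 2] unifies with [x * x]. *)
Ltac nneg := repeat first [ assumption | exact: sqr_ge0 | exact: normr_ge0
  | exact: ler01 | exact: ler0n | apply: addr_ge0 | apply: mulr_ge0
  | rewrite invr_ge0 ].

(** * Suprema defining dual norms *)

Section DualNorm.
Context (R : realType) (T : Type) (nu : T -> R) (X : set T).
Implicit Types g h : T -> R.

Lemma dual_norm_ub g M :
  (forall x, X x -> nu x <= 1 -> g x <= M) ->
  forall x, X x -> nu x <= 1 -> g x <= dual_norm nu X g.
Proof.
move=> gM x Xx x1; apply: ub_le_sup; last by exists x.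
by exists M => _ [y [Xy y1] <-]; exact: gM.
Qed.

Lemma dual_norm_le g M : (exists2 x0, X x0 & nu x0 <= 1) ->
  (forall x, X x -> nu x <= 1 -> g x <= M) -> dual_norm nu X g <= M.
Proof.
move=> [x0 Xx0 x01] gM; apply: ge_sup; first by exists (g x0), x0.
by move=> _ [y [Xy y1] <-]; exact: gM.
Qed.

End DualNorm.

Lemma op_norm_dual (R : realType) (T U : Type) (nu : T -> R) (mu : U -> R)
    (L : T -> U) : op_norm nu mu L = dual_norm nu [set: T] (mu \o L).
Proof.
rewrite /op_norm /dual_norm; congr sup.
apply/seteqP; split=> y.
  by case=> x x1 <-; exists x.
by case=> x [_ x1] <-; exists x.
Qed.

Section Homogeneous.
Context (R : realType) (U : lmodType R) (nu : U -> R) (X : set U).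
Hypothesis nu_ge0 : forall x, 0 <= nu x.
Hypothesis nuZ : forall c x, 0 <= c -> nu (c *: x) = c * nu x.
Hypothesis XZ : forall c x, 0 <= c -> X x -> X (c *: x).

(** Normalizing [x] breaks down when [nu x = 0]; there the bound [gM] forces
    [g x <= 0]. *)
Lemma le_dual_norm_homo (g : U -> R) M :
  (forall c x, 0 <= c -> g (c *: x) = c * g x) ->
  (forall x, X x -> g x <= M * nu x) ->
  forall x, X x -> g x <= dual_norm nu X g * nu x.
Proof.
move=> gZ gM x Xx; have := nu_ge0 x; rewrite le_eqVlt => /predU1P[x0|x0].
  by rewrite -x0 mulr0; have := gM _ Xx; rewrite -x0 mulr0.
rewrite -ler_pdivrMr// mulrC -gZ ?invr_ge0 ?(ltW x0)//.
have gM' y : X y -> nu y <= 1 -> g y <= `|M|.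
  move=> Xy y1; apply: (le_trans (gM _ Xy)).
  apply: (@le_trans _ _ (`|M| * nu y)); first by rewrite ler_wpM2r// ler_norm.
  by rewrite ler_piMr.
apply: (dual_norm_ub gM'); first by apply: XZ => //; rewrite invr_ge0 ltW.
by rewrite nuZ ?invr_ge0 ?(ltW x0)// mulVf// gt_eqF.
Qed.

End Homogeneous.

(** * Euclidean geometry *)

Section Dot.
Context (R : realType) (W : normedModType R) (b : {dot W for idfun}).
Hypothesis normE : forall w : W, `|w| = Num.sqrt (b w w).

Lemma dotC u v : b u v = b v u.
Proof. by rewrite (hermC b u v) expr0 mul1r. Qed.

Lemma dot_ge0 u : 0 <= b u u.
Proof.
have [->|u0] := eqVneq u 0; first by rewrite linear0r.
exact/ltW/neq0_dnorm_gt0.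
Qed.

Lemma dot_sqr u : b u u = `|u| ^+ 2.
Proof. by rewrite normE sqr_sqrtr// dot_ge0. Qed.

Lemma sqr_norm_dotB u v : `|u - v| ^+ 2 = `|u| ^+ 2 - 2 * b u v + `|v| ^+ 2.
Proof. by rewrite -!dot_sqr linearBl !linearBr /= (dotC v u); ring. Qed.

Lemma cauchy_schwarz u v : b u v <= `|u| * `|v|.
Proof.
have [->|u0] := eqVneq u 0; first by rewrite linear0l normr0 mul0r.
have [->|v0] := eqVneq v 0; first by rewrite linear0r normr0 mulr0.
have := sqr_ge0 `|(`|v| *: u - `|u| *: v)|.
have e (c d : R) : b (c *: u) (d *: v) = c * (d * b u v).
  by rewrite linearZl_LR linearZr_LR.
rewrite sqr_norm_dotB e !normrZ !normr_id => h.
have uv0 : 0 < `|u| * `|v| by rewrite mulr_gt0 ?normr_gt0.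
rewrite -subr_ge0 -(pmulr_rge0 _ uv0).
by nra.
Qed.

Lemma cauchy_schwarz_abs u v : `|b u v| <= `|u| * `|v|.
Proof.
rewrite ler_norml cauchy_schwarz andbT lerNl -linearNl.
by rewrite -(normrN u) cauchy_schwarz.
Qed.

End Dot.
(** * Linear maps on finite-dimensional spaces *)

(** Expand [v] in a basis [e], with coordinate row [x], and let [G] be the Gram
    matrix of [T e]. The entries of [x *m G] are the products of [T v] with the
    [T e`_i], hence bounded by [`|T v|]; since the kernel of [G] is that of [T],
    on which [L] vanishes, [L v] is a linear function of [x *m G]. *)
Lemma finite_dim_bounded (R : realType) (E : vectType R)
    (W : normedModType R) (b : {dot W for idfun}) (X : normedModType R)
    (T : {linear E -> W}) (L : {linear E -> X}) :
  (forall w : W, `|w| = Num.sqrt (b w w)) ->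
  (forall v, T v = 0 -> L v = 0) ->
  exists2 K : R, 0 <= K & forall v, `|L v| <= K * `|T v|.
Proof.
move=> normE TL.
set n := \dim (fullv : {vspace E}); pose e := vbasis (fullv : {vspace E}).
pose G : 'M[R]_n := \matrix_(i, j) b (T e`_i) (T e`_j).
pose comb (x : 'rV[R]_n) : E := \sum_(i < n) x 0 i *: e`_i.
have combB x y : comb (x - y) = comb x - comb y.
  by rewrite /comb -sumrB; apply: eq_bigr => i _; rewrite !mxE scalerBl.
have gramE x (j : 'I_n) : (x *m G) 0 j = b (T (comb x)) (T e`_j).
  rewrite !mxE /comb linear_sum linear_sumlz; apply: eq_bigr => i _.
  by rewrite !mxE linearZ linearZl_LR.
have T0 x : x *m G = 0 -> T (comb x) = 0.
  move=> xG; apply/eqP; rewrite -normr_eq0 -sqrf_eq0 -(dot_sqr normE).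
  rewrite {2}/comb [X in b _ X]linear_sum linear_sumr big1// => i _.
  by rewrite linearZ linearZr_LR /= -gramE xG mxE mulr0.
pose K := \sum_(i < n) `|T e`_i| * `|L (comb (row i (pinvmx G)))|.
exists K; first by apply: sumr_ge0 => i _; rewrite mulr_ge0.
move=> v; pose x : 'rV[R]_n := \row_i coord e i v.
have vE : v = comb x.
  rewrite {1}(coord_vbasis (memvf v)); apply: eq_bigr => i _.
  by rewrite !mxE.
(* [x] and [x *m G *m pinvmx G] differ by an element of the kernel of [G] *)
have LvE : L v = \sum_(i < n) (x *m G) 0 i *: L (comb (row i (pinvmx G))).
  have -> : L v = L (comb (x *m G *m pinvmx G)).
    apply/eqP; rewrite -subr_eq0 -linearB vE -combB TL// T0//.
    by rewrite mulmxBl -(mulmxA x G) -(mulmxA x _ G) mulmxKpV// subrr.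
  have combM y (P : 'M[R]_n) :
      comb (y *m P) = \sum_(i < n) y 0 i *: comb (row i P).
    rewrite /comb; under [RHS]eq_bigr do rewrite scaler_sumr.
    rewrite exchange_big; apply: eq_bigr => j _.
    by rewrite mxE scaler_suml; apply: eq_bigr => i _; rewrite mxE scalerA.
  by rewrite combM linear_sum; apply: eq_bigr => i _; rewrite linearZ.
rewrite LvE; apply: (le_trans (ler_norm_sum _ _ _)).
rewrite /K mulr_suml; apply: ler_sum => i _.
rewrite normrZ mulrAC ler_wpM2r// gramE -vE mulrC.
exact: cauchy_schwarz_abs.
Qed.

Lemma row_free_surjective (F : fieldType) m n (M : 'M[F]_(n, m))
    (g : 'rV[F]_m) :
  (m <= n)%N -> row_free M -> exists c : 'rV[F]_n, c *m M = g.
Proof.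
move=> mn /eqP rk; have : (g <= M)%MS.
  apply: submx_full; rewrite /row_full eqn_leq rank_leq_col /= rk mn//.
by move=> /submxP[c ->]; exists c.
Qed.
(** * Functionals on subspaces *)

Lemma submod_setP (R : realType) (E : lmodType R) (X : set E) :
  submod_closed [in X] ->
  X 0 /\ forall c u v, X u -> X v -> X (c *: u + v).
Proof.
move=> [X0 XL]; split=> [|c u v Xu Xv]; first by rewrite inE in X0.
by have := XL c u v (mem_set Xu) (mem_set Xv); rewrite inE.
Qed.

Lemma submod_setZ (R : realType) (E : lmodType R) (X : set E) :
  submod_closed [in X] -> forall c u, X u -> X (c *: u).
Proof.
by move=> /submod_setP[X0 XL] c u Xu; rewrite -[_ *: _]addr0; apply: XL.
Qed.

Section Subspace.
Context (R : realType) (V : normedModType R) (Y : set V).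
Hypothesis Ysub : submod_closed [in Y].
Implicit Types (X : set V) (chi psi : Y -> R^o).

Let elt v (Yv : Y v) : Y := SigSub (mem_set Yv).

Lemma dual_spaceN chi psi : dual_space psi -> (forall x, chi x = - psi x) ->
  dual_space chi.
Proof.
move=> [psiL [M psiM]] chiE; split=> [c x y s sE|].
  by rewrite !chiE (psiL c x y s sE); ring.
by exists M => x; rewrite chiE normrN.
Qed.

Lemma dual_spaceD rho chi psi : dual_space chi -> dual_space psi ->
  (forall x, rho x = chi x + psi x) -> dual_space rho.
Proof.
move=> [chiL [M chiM]] [psiL [N psiN]] rhoE; split=> [c x y s sE|].
  by rewrite !rhoE (chiL c x y s sE) (psiL c x y s sE); ring.
exists (M + N) => x; rewrite rhoE mulrDl (le_trans (ler_normD _ _))//.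
by rewrite lerD.
Qed.

Lemma sigL_dual_space (g : {scalar V}) M : (forall v, `|g v| <= M * `|v|) ->
  dual_space (sigL Y (g : V -> R^o)).
Proof.
move=> gM; split=> [c x y s sE|]; last by exists M => x; exact: gM.
by rewrite -[LHS]/(g (\val s)) sE linearP.
Qed.

Lemma loc_norm_ub X chi : dual_space chi ->
  forall x, X (\val x) -> `|\val x| <= 1 -> chi x <= loc_norm X chi.
Proof.
move=> [_ [M chiM]] x Xx x1.
apply: (@dual_norm_ub _ _ (fun y : Y => `|\val y|) _ chi `|M|) => // y _ y1.
rewrite (le_trans (ler_norm _))// (le_trans (chiM y))//.
by rewrite (le_trans (ler_wpM2r _ (ler_norm M)))// ler_piMr.
Qed.

Lemma loc_norm_le X chi M : X 0 ->
  (forall x, X (\val x) -> `|\val x| <= 1 -> chi x <= M) -> loc_norm X chi <= M.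
Proof.
move=> X0; have [Y0 _] := submod_setP Ysub.
by apply: dual_norm_le; exists (elt Y0) => //=; rewrite normr0.
Qed.

Lemma loc_normD X rho chi psi : X 0 -> dual_space chi -> dual_space psi ->
  (forall x, rho x = chi x + psi x) ->
  loc_norm X rho <= loc_norm X chi + loc_norm X psi.
Proof.
move=> X0 Dchi Dpsi rhoE; apply: loc_norm_le => // x Xx x1.
by rewrite rhoE lerD// loc_norm_ub.
Qed.

Lemma dual_space0 chi x : dual_space chi -> \val x = 0 -> chi x = 0.
Proof.
move=> [chiL _] x0; have := chiL (-1) x x x.
by rewrite x0 scaler0 addr0 mulN1r addNr => ->.
Qed.

Lemma loc_norm_ge0 X chi : X 0 -> dual_space chi -> 0 <= loc_norm X chi.
Proof.
move=> X0 Dchi; have [Y0 _] := submod_setP Ysub.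
rewrite -(@dual_space0 chi (elt Y0))//; apply: loc_norm_ub => //=.
by rewrite normr0.
Qed.

Lemma dual_space_opp chi x y : dual_space chi -> \val y = - \val x ->
  chi y = - chi x.
Proof.
move=> Dchi yE; have [Y0 _] := submod_setP Ysub.
have [chiL _] := Dchi; rewrite (chiL (-1) x (elt Y0) y) ?yE ?scaleN1r ?addr0//.
by rewrite (@dual_space0 _ (elt Y0))// addr0 mulN1r.
Qed.

Lemma loc_normN_le X chi psi : submod_closed [in X] -> dual_space psi ->
  (forall x, chi x = - psi x) -> loc_norm X chi <= loc_norm X psi.
Proof.
move=> Xsub Dpsi chiE; have [X0 _] := submod_setP Xsub.
apply: loc_norm_le => // x Xx x1.
have Yx : Y (- \val x).
  by rewrite -scaleN1r; apply: submod_setZ (set_mem (valP x)).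
rewrite chiE -(@dual_space_opp _ x (elt Yx))// loc_norm_ub//= ?normrN//.
by rewrite -scaleN1r; exact: submod_setZ.
Qed.

Lemma loc_norm_sigL X (g : V -> R^o) : X `<=` Y ->
  loc_norm X (sigL Y g) = dual_norm (fun v : V => `|v|) X (g : V -> R).
Proof.
move=> XY; rewrite /loc_norm /dual_norm; congr sup; apply/seteqP; split=> t.
  by case=> x [Xx x1] <-; exists (\val x).
by case=> v [Xv v1] <-; exists (elt (XY _ Xv)).
Qed.

Lemma dual_space_sum chi n (x : 'I_n -> Y) (c : 'I_n -> R) (s : Y) :
  dual_space chi -> \val s = \sum_(i < n) c i *: \val (x i) ->
  chi s = \sum_(i < n) c i * chi (x i).
Proof.
move=> Dchi; have [chiL _] := Dchi; have [Y0 YL] := submod_setP Ysub.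
elim: n x c s => [|n IH] x c s.
  by rewrite !big_ord0 => /(dual_space0 Dchi).
rewrite !big_ord_recl => sE.
have YT : Y (\sum_(i < n) c (lift ord0 i) *: \val (x (lift ord0 i))).
  elim/big_ind: _ => // [u v Yu Yv|i _].
    by rewrite -[u]scale1r; exact: YL.
  by apply: submod_setZ => //; exact: set_mem (valP (x _)).
rewrite (chiL (c ord0) (x ord0) (elt YT))//.
by rewrite (IH (x \o lift ord0) (c \o lift ord0) (elt YT)).
Qed.

Lemma loc_norm0_vanish X chi : submod_closed [in X] -> dual_space chi ->
  loc_norm X chi <= 0 -> forall x, X (\val x) -> chi x = 0.
Proof.
move=> Xsub Dchi chi0.
have le0 x : X (\val x) -> chi x <= 0.
  move=> Xx; have [x0|x0] := eqVneq (\val x) 0.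
    by rewrite (dual_space0 Dchi).
  have Yx : Y (`|\val x|^-1 *: \val x) by apply: submod_setZ (set_mem (valP x)).
  have [chiL _] := Dchi; have [Y0 _] := submod_setP Ysub.
  have := @loc_norm_ub X chi Dchi (elt Yx) (submod_setZ Xsub _ Xx).
  rewrite /= normrZ normrV ?unitfE ?normr_eq0// normr_id mulVf ?normr_eq0//.
  move=> /(_ (lexx _))/le_trans/(_ chi0).
  rewrite (chiL `|\val x|^-1 x (elt Y0)) ?addr0//.
  by rewrite (@dual_space0 _ (elt Y0))// addr0 pmulr_rle0// invr_gt0 normr_gt0.
move=> x Xx; apply/eqP; rewrite eq_le le0//= -oppr_le0.
have Yx : Y (- \val x).
  by rewrite -scaleN1r; apply: submod_setZ (set_mem (valP x)).
rewrite -(@dual_space_opp _ x (elt Yx))//; apply: le0.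
by rewrite /= -scaleN1r; exact: submod_setZ.
Qed.

End Subspace.
Lemma sqr_le_doubleD (R : realType) (x p q : R) :
  0 <= x -> x <= p + q -> x ^+ 2 <= 2 * (p ^+ 2 + q ^+ 2).
Proof.
move=> x0 xpq; have := sqr_ge0 (p - q).
have : x ^+ 2 <= (p + q) ^+ 2 by rewrite ler_pXn2r// nnegrE (le_trans x0).
by rewrite !expr2; lra.
Qed.

(** * Local projections and the local residual *)

Section LocalEstimates.
Context (R : realType) (V : normedModType R) (X S : set V).
Let Y := sum_space X S.
Context (D : set (Y -> R^o)) (CL : R).
Hypotheses (Xsub : submod_closed [in X]) (Ssub : submod_closed [in S]).
Hypotheses (Dsub : submod_closed [in D]) (Ddual : D `<=` @dual_space _ _ Y).
Hypothesis DX : forall chi, D chi -> loc_norm X chi <= CL * loc_norm S chi.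

Lemma sub_sum_l : X `<=` Y.
Proof.
have [S0 _] := submod_setP Ssub => x Xx.
by exists x => //; exists 0 => //; rewrite addr0.
Qed.

Lemma sub_sum_r : S `<=` Y.
Proof.
have [X0 _] := submod_setP Xsub => s Ss.
by exists 0 => //; exists s => //; rewrite add0r.
Qed.

Lemma sum_space_submod : submod_closed [in Y].
Proof.
have [X0 XL] := submod_setP Xsub; have [S0 SL] := submod_setP Ssub.
split; first by rewrite inE; apply: sub_sum_l.
move=> c _ _ /[!inE] -[x Xx [s Ss <-]] [x' Xx' [s' Ss' <-]].
exists (c *: x + x'); first exact: XL.
by exists (c *: s + s'); [exact: SL|rewrite scalerDr addrACA].
Qed.

(** Vanishing on [S] makes the right-hand side of [DX] zero, so that [chi]
    vanishes on [X] as well, hence on the sum. *)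
Lemma dual_vanish chi : D chi -> (forall s : Y, S (\val s) -> chi s = 0) ->
  chi = 0.
Proof.
move=> Dchi chiS; have chid := Ddual Dchi.
have [X0 _] := submod_setP Xsub; have [S0 _] := submod_setP Ssub.
have chiX : forall x : Y, X (\val x) -> chi x = 0.
  apply: (loc_norm0_vanish sum_space_submod Xsub chid).
  apply: (le_trans (DX Dchi)).
  have -> : loc_norm S chi = 0; last by rewrite mulr0.
  apply/eqP; rewrite eq_le (loc_norm_ge0 sum_space_submod)// andbT.
  by apply: (loc_norm_le sum_space_submod) => // s Ss _; rewrite chiS.
apply/funext => y; have [x Xx [s Ss xsE]] := set_mem (valP y).
have [chiL _] := chid.
pose yx : Y := SigSub (mem_set (sub_sum_l Xx)).
pose ys : Y := SigSub (mem_set (sub_sum_r Ss)).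
rewrite (chiL 1 yx ys y) ?mul1r ?(chiX yx) ?(chiS ys) ?addr0//=.
by rewrite scale1r xsE.
Qed.

(** Restriction to [S] is injective on [D] by [dual_vanish], so the pairing of
    bases of [D] and [S] has full row rank; as [dim S <= dim D] it is square and
    every functional on [S] is attained. *)
Lemma loc_projP m n (g : Y -> R^o) : has_dim S m -> has_dim D n -> (m <= n)%N ->
  dual_space g ->
  D (loc_proj S D g) /\ forall s : Y, S (\val s) -> loc_proj S D g s = g s.
Proof.
move=> [e [_ SE]] [chi [chi_free DE]] mn gd.
suff : exists psi : Y -> R^o, D psi /\ forall s : Y, S (\val s) -> psi s = g s.
  by move=> /(xgetPex 0).
have Se i : S (e i).
  rewrite SE; exists (fun j => (j == i)%:R) => //.
  rewrite (bigD1 i)//= eqxx scale1r big1 ?addr0// => j /negbTE ->.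
  by rewrite scale0r.
have Dcomb (c : 'I_n -> R) : D (\sum_(j < n) c j *: chi j).
  by rewrite DE; exists c.
have Dchi j : D (chi j).
  rewrite DE; exists (fun k => (k == j)%:R) => //.
  rewrite (bigD1 j)//= eqxx scale1r big1 ?addr0// => k /negbTE ->.
  by rewrite scale0r.
pose E i : Y := SigSub (mem_set (sub_sum_r (Se i))).
pose M : 'M[R]_(n, m) := \matrix_(j, i) chi j (E i).
have combE (c : 'I_n -> R) (y : Y) :
    (\sum_(j < n) c j *: chi j) y = \sum_(j < n) c j * chi j y.
  by rewrite fct_sumE.
have onS psi h : dual_space psi -> dual_space h ->
    (forall i, psi (E i) = h (E i)) ->
    forall s : Y, S (\val s) -> psi s = h s.
  move=> psid hd psih s; rewrite {1}SE => -[c _ sE].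
  rewrite (dual_space_sum sum_space_submod psid (x := E) (c := c))//.
  rewrite (dual_space_sum sum_space_submod hd (x := E) (c := c))//.
  by apply: eq_bigr => i _; rewrite psih.
have Mfree : row_free M.
  apply: inj_row_free => v vM; apply/rowP => j; rewrite mxE.
  apply: (chi_free (v 0)); apply: dual_vanish => // s Ss.
  have zd : dual_space (0 : Y -> R^o).
    split=> [k x y s1 _|]; first by rewrite -[RHS]/(k * 0 + 0) mulr0 addr0.
    by exists 0 => x; rewrite normr0 mul0r.
  apply: (onS _ 0 (Ddual (Dcomb _)) zd) => // i.
  have /rowP/(_ i) := vM; rewrite !mxE => vMi; rewrite combE -[RHS]vMi.
  by apply: eq_bigr => k _; rewrite mxE.
have [c cM] := row_free_surjective (\row_i (g (E i) : R)) mn Mfree.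
exists (\sum_(j < n) c 0 j *: chi j); split=> // s Ss.
apply: (onS _ g (Ddual (Dcomb _)) gd) => // i.
have /rowP/(_ i) := cM; rewrite !mxE combE => <-.
by apply: eq_bigr => k _; rewrite mxE.
Qed.

Section LocalResidual.
Context (g r : {scalar V}) (A : Y -> R^o) (Mg Mr : R).
Hypothesis gM : forall v, `|g v| <= Mg * `|v|.
Hypothesis rM : forall v, `|r v| <= Mr * `|v|.
Hypothesis rE : forall y : Y, r (\val y) = g (\val y) - A y.
Hypothesis DA : D A.
Hypothesis dimSD :
  exists m n : nat, [/\ has_dim S m, has_dim D n & (m <= n)%N].

Let P := loc_proj S D (sigL Y (g : V -> R^o)).
Let rY := sigL Y (r : V -> R^o).

Let gd : dual_space (sigL Y (g : V -> R^o)).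
Proof. exact: sigL_dual_space gM. Qed.

Let rd : dual_space rY.
Proof. exact: sigL_dual_space rM. Qed.

Let PP : D P /\ forall s : Y, S (\val s) -> P s = g (\val s).
Proof. by have [m [n [Sm Dn mn]]] := dimSD; exact: loc_projP Sm Dn mn gd. Qed.

Let DPA : D (P \- A).
Proof.
have [DP _] := PP; have [_ DL] := submod_setP Dsub.
have -> : P \- A = -1 *: A + P; last exact: DL.
by apply/funext => y; rewrite scaleN1r addrC.
Qed.

Let X0 : X 0. Proof. by have [] := submod_setP Xsub. Qed.

Let dualX (h : V -> R) := dual_norm (fun v : V => `|v|) X h.
Let dualS (h : V -> R) := dual_norm (fun v : V => `|v|) S h.

Let dualXE : dualX r = loc_norm X rY.
Proof. by rewrite /rY loc_norm_sigL//; exact: sub_sum_l. Qed.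

(** The inverse estimate on [D] moves the norm from [X] to [S], where the
    projection cannot be told from the data. *)
Lemma discrete_residual_le :
  loc_norm X (P \- A) ^+ 2 <= CL ^+ 2 * dualS r ^+ 2.
Proof.
have [_ PS] := PP; have := DX DPA.
have -> : loc_norm S (P \- A) = dualS r.
  rewrite /dualS -(loc_norm_sigL _ sub_sum_r).
  rewrite /loc_norm /dual_norm; congr sup; apply: eq_imagel => y [Sy _] /=.
  by rewrite PS// -rE.
have PA0 := loc_norm_ge0 sum_space_submod X0 (Ddual DPA).
by move=> h; rewrite -exprMn ler_pXn2r// nnegrE (le_trans PA0).
Qed.

Let gPd : dual_space (sigL Y (g : V -> R^o) \- P).
Proof.
have [DP _] := PP.
by apply: (dual_spaceD gd (dual_spaceN (Ddual DP) (fun=> erefl))) => y.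
Qed.

Lemma local_residual_le :
  dualX r ^+ 2 <= 2 * (loc_norm X (P \- A) ^+ 2 +
                       loc_norm X (sigL Y (g : V -> R^o) \- P) ^+ 2).
Proof.
rewrite dualXE; apply: sqr_le_doubleD.
  exact: (loc_norm_ge0 sum_space_submod X0 rd).
apply: (loc_normD sum_space_submod X0 (Ddual DPA) gPd) => y.
rewrite -[LHS]/(r (\val y)) rE.
by rewrite -[RHS]/((P y - A y) + (g (\val y) - P y)); ring.
Qed.

Lemma oscillation_le :
  loc_norm X (sigL Y (g : V -> R^o) \- P) ^+ 2 <=
  2 * (dualX r ^+ 2 + loc_norm X (P \- A) ^+ 2).
Proof.
rewrite dualXE; apply: sqr_le_doubleD.
  exact: (loc_norm_ge0 sum_space_submod X0 gPd).
have Nd : dual_space (fun y => - (P \- A) y : R^o).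
  exact: dual_spaceN (Ddual DPA) (fun=> erefl).
have := loc_normN_le sum_space_submod Xsub (Ddual DPA)
  (fun y => erefl (- (P \- A) y)).
move=> /(lerD (lexx (loc_norm X rY))); apply: le_trans.
apply: (loc_normD sum_space_submod X0 rd Nd) => y.
rewrite -[RHS]/(r (\val y) + - (P y - A y)) rE.
by rewrite -[LHS]/(g (\val y) - P y); ring.
Qed.

End LocalResidual.
End LocalEstimates.
(** * Residuals and localization *)

Lemma continuous_functional_bounded (R : realType) (V : normedModType R)
    (g : {scalar V}) :
  continuous (g : V -> R) <-> exists M, forall v, `|g v| <= M * `|v|.
Proof.
pose h : {linear V -> R^o} :=
  HB.pack (g : V -> R^o) (GRing.isLinear.Build R V R^o *:%R g (linearP g)).
split=> [gc|[M gM]].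
  have /linear_bounded_continuous/linear_boundedP hb : continuous h := gc.
  have [M [_ hM]] := hb; exists (M + 1); apply: hM.
  by rewrite ltrDl.
suff : continuous h by [].
apply/linear_bounded_continuous/linear_boundedP; exists M; split.
  exact: num_real.
move=> N MN v; apply: (le_trans (gM v)); rewrite ler_wpM2r//; exact: ltW.
Qed.

Section Residual.
Context (R : realType) (V : normedModType R) (a : {dot V for idfun}).
Hypothesis normE : forall v : V, `|v| = Num.sqrt (a v v).
Context (Z : finType) (Vz : Z -> set V).
Hypothesis Vsub : forall z, submod_closed [in Vz z].
Implicit Types w : V.

Let rho w z := dual_norm (fun v : V => `|v|) (Vz z) (a w).

Lemma le_dual_norm_riesz w z v : Vz z v -> a w v <= rho w z * `|v|.
Proof.
apply: (@le_dual_norm_homo _ _ (fun v : V => `|v|) _ _ _ _ (a w) `|w|) => //.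
- by move=> c x c0; rewrite normrZ ger0_norm.
- by move=> c x _; exact: submod_setZ.
- by move=> c x _; rewrite linearZr_LR.
- by move=> x _; exact: cauchy_schwarz.
Qed.

Lemma dual_norm_riesz_ge0 w z : 0 <= rho w z.
Proof.
have [V0 _] := submod_setP (Vsub z); have := cauchy_schwarz normE w.
move=> cs; rewrite -[leLHS](linear0r a w).
apply: (@dual_norm_ub _ _ (fun v : V => `|v|) _ (a w) `|w|) => //; last first.
  by rewrite normr0.
by move=> x _ x1; rewrite (le_trans (cs x))// ler_piMr.
Qed.

(** Young's inequality leaves [`|w| ^+ 2 / 4] on the right for each of the two
    contributions to [a w w], so that half of [a w w] can be absorbed. *)
Lemma residual_reliable w e (v : Z -> V) Cloc B :
  0 < Cloc -> w = \sum_z v z + e -> (forall z, Vz z (v z)) ->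
  \sum_z `|v z| ^+ 2 <= Cloc ^+ 2 * `|w| ^+ 2 -> a w e <= B * `|w| ->
  `|w| ^+ 2 <= 2 * (Cloc ^+ 2 * \sum_z rho w z ^+ 2 + B ^+ 2).
Proof.
move=> C0 wE vz vC eB.
have : a w w <= Cloc ^+ 2 * \sum_z rho w z ^+ 2 + `|w| ^+ 2 / 4 + B * `|w|.
  rewrite {2}wE linearDr linear_sumr /= lerD//.
  apply: (@le_trans _ _ (\sum_z (Cloc ^+ 2 * rho w z ^+ 2
                                 + (4 * Cloc ^+ 2)^-1 * `|v z| ^+ 2))).
    apply: ler_sum => z _; apply: (le_trans (le_dual_norm_riesz _ (vz z))).
    have := sqr_ge0 (Cloc * rho w z - (2 * Cloc)^-1 * `|v z|).
    rewrite sqrrB !exprMn exprVn exprMn.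
    have -> : Cloc * rho w z * ((2 * Cloc)^-1 * `|v z|) = rho w z * `|v z| / 2.
      by field; rewrite gt_eqF.
    have -> : (2 : R) ^+ 2 = 4 by ring.
    by lra.
  rewrite big_split /= -!mulr_sumr lerD2l.
  rewrite mulrC ler_pdivrMr ?mulr_gt0 ?exprn_gt0//.
  by apply: (le_trans vC); lra.
rewrite (dot_sqr normE); have := sqr_ge0 (B - `|w| / 2).
by rewrite !expr2; lra.
Qed.

(** Testing with a combination of near-maximisers of the local dual norms; the
    factor 4 pays for their being only half-optimal. *)
Lemma residual_efficient w Ccol : 0 < Ccol ->
  (forall v : Z -> V, (forall z, Vz z (v z)) ->
     `|\sum_z v z| ^+ 2 <= Ccol ^+ 2 * \sum_z `|v z| ^+ 2) ->
  \sum_z rho w z ^+ 2 <= 4 * Ccol ^+ 2 * `|w| ^+ 2.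
Proof.
move=> C0 col.
have /choice[v vP] z : exists v, [/\ Vz z v, `|v| <= 1 & rho w z <= 2 * a w v].
  have [V0 _] := submod_setP (Vsub z).
  have := dual_norm_riesz_ge0 w z; rewrite le_eqVlt => /predU1P[<-|r0].
    by exists 0; rewrite normr0 linear0r mulr0; split.
  have : rho w z / 2 < rho w z by lra.
  move/sup_gt => [].
    by exists (a w 0); exists 0 => //; split=> //; rewrite normr0.
  by move=> _ [v [Vv v1] <-] rv; exists v; split=> //; lra.
have vz z : Vz z (rho w z *: v z).
  by case: (vP z) => Vv _ _; exact: submod_setZ.
set s := \sum_z rho w z ^+ 2; set t := \sum_z rho w z *: v z.
have ts : `|t| ^+ 2 <= Ccol ^+ 2 * s.
  apply: (le_trans (col _ vz)); rewrite ler_pM2l ?exprn_gt0//.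
  apply: ler_sum => z _; case: (vP z) => _ v1 _.
  rewrite normrZ exprMn real_normK ?num_real// ler_piMr ?sqr_ge0//.
  by rewrite expr_le1.
have st : s <= 2 * a w t.
  rewrite /s /t linear_sumr mulr_sumr; apply: ler_sum => z _.
  case: (vP z) => _ _ rv; rewrite linearZr_LR /= expr2 mulrCA.
  by rewrite ler_wpM2l// dual_norm_riesz_ge0.
have cs := cauchy_schwarz normE w t.
have := sqr_ge0 (2 * Ccol ^+ 2 * `|w| - `|t|).
have C2 : 0 < 2 * Ccol ^+ 2 by rewrite mulr_gt0 ?exprn_gt0.
have t2 : 2 * Ccol ^+ 2 * s <= (2 * Ccol ^+ 2) * (4 * Ccol ^+ 2 * `|w| ^+ 2) ->
  s <= 4 * Ccol ^+ 2 * `|w| ^+ 2 by rewrite ler_pM2l.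
move=> sq; apply: t2; set c := Ccol ^+ 2 in ts C2 sq *.
have : 2 * c * s <= 2 * c * (2 * (`|w| * `|t|)) by rewrite ler_pM2l//; lra.
by move: sq ts; rewrite !expr2; lra.
Qed.

End Residual.

(** * Boundedness of the discrete form *)

Lemma finite_dim_functional_bounded (R : realType) (E : vectType R)
    (W : normedModType R) (b : {dot W for idfun}) (T : {linear E -> W})
    (g : {scalar E}) :
  (forall w : W, `|w| = Num.sqrt (b w w)) -> injective T ->
  exists2 K : R, 0 <= K & forall v, `|g v| <= K * `|T v|.
Proof.
move=> normE Tinj.
pose h : {linear E -> R^o} :=
  HB.pack (g : E -> R^o) (GRing.isLinear.Build R E R^o *:%R g (linearP g)).
apply: (finite_dim_bounded (L := h) normE) => v.
by rewrite -(linear0 T) => /Tinj ->; rewrite linear0.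
Qed.

Section DiscreteForm.
Context (R : realType) (Vh : vectType R) (Vt : normedModType R).
Context (b : {dot Vt for idfun}) (jh : {linear Vh -> Vt}) (ah : {biscalar Vh}).
Hypothesis normE : forall w : Vt, `|w| = Num.sqrt (b w w).
Hypothesis jh_inj : injective jh.

(** The norms of [A_h] and of its adjoint are suprema with a default value; this
    bound makes them genuine. *)
Lemma discrete_form_bounded :
  exists2 K : R, 0 <= K & forall x v, `|ah x v| <= K * `|jh x| * `|jh v|.
Proof.
pose e := vbasis (fullv : {vspace Vh}).
have /choice[L Lb] (j : 'I_(\dim (fullv : {vspace Vh}))) :
    exists L, 0 <= L /\ forall v, `|coord e j v| <= L * `|jh v|.
  pose g : {scalar Vh} := HB.pack (coord e j : Vh -> R)
    (GRing.isLinear.Build R Vh R *%R (coord e j) (linearP (coord e j))).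
  by have [L L0 Lb] := finite_dim_functional_bounded g normE jh_inj; exists L.
have /choice[M Mb] (j : 'I_(\dim (fullv : {vspace Vh}))) :
    exists M, 0 <= M /\ forall x, `|ah x e`_j| <= M * `|jh x|.
  pose g : {scalar Vh} := HB.pack ((fun x => ah x e`_j) : Vh -> R)
    (GRing.isLinear.Build R Vh R *%R (fun x => ah x e`_j) (linearPl ah e`_j)).
  by have [K K0 Kb] := finite_dim_functional_bounded g normE jh_inj; exists K.
exists (\sum_j M j * L j).
  by apply: sumr_ge0 => j _; rewrite mulr_ge0//; [case: (Mb j)|case: (Lb j)].
move=> x v; rewrite {1}(coord_vbasis (memvf v)) linear_sumr.
apply: (le_trans (ler_norm_sum _ _ _)); rewrite !mulr_suml.
apply: ler_sum => j _; have [[M0 Mx] [L0 Lv]] := (Mb j, Lb j).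
rewrite linearZr_LR /= normrM.
have -> : M j * L j * `|jh x| * `|jh v| = (L j * `|jh v|) * (M j * `|jh x|).
  by ring.
by rewrite ler_pM.
Qed.

Lemma norm_h_ge0 v : 0 <= norm_h jh v. Proof. exact: normr_ge0. Qed.

Lemma norm_hZ c v : 0 <= c -> norm_h jh (c *: v) = c * norm_h jh v.
Proof. by move=> c0; rewrite /norm_h linearZ normrZ ger0_norm. Qed.

Let form_ub w : forall x, [set: Vh] x -> norm_h jh x <= 1 ->
  ah w x <= dual_norm_h jh (ah w).
Proof.
have [K K0 Kb] := discrete_form_bounded.
apply: (@dual_norm_ub _ _ _ _ (ah w) (K * `|jh w|)) => x _ x1.
rewrite (le_trans (ler_norm _))// (le_trans (Kb w x))//.
by rewrite ler_piMr// mulr_ge0.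
Qed.

Let Ah_ub : forall x, [set: Vh] x -> norm_h jh x <= 1 ->
  dual_norm_h jh (ah x) <= norm_Ah jh ah.
Proof.
have [K K0 Kb] := discrete_form_bounded; rewrite /norm_Ah op_norm_dual.
apply: (@dual_norm_ub _ _ _ _ _ K) => x _ x1; apply: dual_norm_le.
  by exists 0 => //; rewrite /norm_h linear0 normr0.
move=> v _ v1; rewrite (le_trans (ler_norm _))// (le_trans (Kb x v))//.
rewrite -mulrA ler_piMr// -[leRHS]mulr1.
by rewrite ler_pM.
Qed.

Lemma norm_Ah_ge0 : 0 <= norm_Ah jh ah.
Proof.
have h0 : norm_h jh 0 <= 1 by rewrite /norm_h linear0 normr0.
apply: le_trans (Ah_ub I h0); rewrite -(linear0r ah 0); exact: form_ub.
Qed.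

Lemma dual_norm_adjoint_le v :
  dual_norm_h jh (fun x => ah x v) <= norm_Ah jh ah * `|jh v|.
Proof.
have [K K0 Kb] := discrete_form_bounded.
apply: dual_norm_le; first by exists 0 => //; rewrite /norm_h linear0 normr0.
move=> x _ x1; apply: (@le_trans _ _ (dual_norm_h jh (ah x) * norm_h jh v)).
  apply: (@le_dual_norm_homo _ _ (norm_h jh) _ _ _ _ (ah x)
    (K * `|jh x|)) => //.
  - exact: norm_h_ge0.
  - exact: norm_hZ.
  - by move=> c y _; rewrite linearZr_LR.
  - by move=> y _; rewrite (le_trans (ler_norm _)).
by apply: ler_wpM2r; [exact: norm_h_ge0|exact: Ah_ub].
Qed.

End DiscreteForm.

(** * The nonconforming setting *)

(** The squares of the constant in the upper bound and of the inverse of the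
    constant in the lower bound. *)
Definition upper_factor (R : realType) (nA nI Cloc C1 C2 : R) : R :=
  1 + 2 * (nA * nI) ^+ 2 / C1 ^+ 2 + 4 * Cloc ^+ 2 / C2 ^+ 2.

Definition lower_factor (R : realType) (Cav Ccol CL CNL C1 C2 delta : R) : R :=
  (1 + C1 ^+ 2 * delta ^+ 2) / Cav ^+ 2 +
  C2 ^+ 2 * ((3 * (CL ^+ 2 * CNL ^+ 2) + 2) * (4 * Ccol ^+ 2)).

Section NonconformingPair.
Context (R : realType) (V : completeNormedModType R) (Vh : vectType R)
  (Vt : normedModType R) (a : {dot V for idfun}) (at_ : {dot Vt for idfun})
  (jV : {linear V -> Vt}) (jh : {linear Vh -> Vt}) (PiV : Vt -> V).
Hypothesis pair : nonconforming_pair a at_ jV jh.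
Hypothesis proj : orthogonal_projection at_ jV PiV.

Let aE (v : V) : `|v| = Num.sqrt (a v v). Proof. by case: pair. Qed.
Let atE (w : Vt) : `|w| = Num.sqrt (at_ w w). Proof. by case: pair. Qed.
Let jVE v v' : at_ (jV v) (jV v') = a v v'. Proof. by case: pair. Qed.

Lemma dot_projection w v : at_ w (jV v) = a (PiV w) v.
Proof. by have := proj w v; rewrite linearBl /= jVE => /subr0_eq. Qed.

Lemma pythagoras w v :
  `|jV v - w| ^+ 2 = `|v - PiV w| ^+ 2 + `|w - jV (PiV w)| ^+ 2.
Proof.
rewrite !(sqr_norm_dotB atE) (sqr_norm_dotB aE) -!(dot_sqr atE) -(dot_sqr aE).
rewrite -(dot_sqr aE) !jVE (dotC at_ (jV v)) !dot_projection (dotC a v).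
ring.
Qed.

Lemma projection_best w v : `|w - jV (PiV w)| <= `|w - jV v|.
Proof.
rewrite (distrC w (jV v)) -(@ler_pXn2r _ 2)// ?nnegrE// pythagoras.
by rewrite lerDr sqr_ge0.
Qed.

Lemma projection_linear : linear (fun w => w - jV (PiV w)).
Proof.
move=> c x y.
have -> : PiV (c *: x + y) = c *: PiV x + PiV y.
  apply/eqP; rewrite -subr_eq0; set d := _ - _.
  rewrite -normr_eq0 -sqrf_eq0 -(dot_sqr aE) {1}/d linearBl linearPl /=.
  by rewrite -!dot_projection linearPl subrr.
by rewrite linearP scalerBr opprD addrACA.
Qed.

(** Finite dimension alone gives the constant: the defect of the averaging map
    vanishes wherever the defect of the projection does. *)
Lemma av_constant_exists (Ah : {linear Vh -> V}) :
  hyp1 jV jh Ah -> exists Cav, av_constant jV jh PiV Ah Cav.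
Proof.
move=> [_ Ah_id].
pose Pl : {linear Vt -> Vt} := HB.pack (fun w => w - jV (PiV w))
  (GRing.isLinear.Build R Vt Vt *:%R _ projection_linear).
pose T : {linear Vh -> Vt} := Pl \o jh.
pose L : {linear Vh -> Vt} := jh \- (jV \o Ah).
have TL v : T v = 0 -> L v = 0.
  by move=> /subr0_eq jvE; rewrite /L /= (Ah_id _ _ jvE) -jvE subrr.
have [K K0 LK] := finite_dim_bounded atE TL.
have K1 : 0 < K + 1 by rewrite ltr_wpDl.
exists (K + 1)^-1; split=> [|v]; first by rewrite invr_gt0.
rewrite ler_pdivrMl//; apply: (le_trans (LK v)).
by rewrite ler_wpM2r// lerDl.
Qed.

Context (ah : {biscalar Vh}) (Eh : {linear Vh -> V}) (delta : R)
  (Ah : {linear Vh -> V}).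
Hypothesis cons : consistency_measure a jV jh PiV ah Eh delta.

Context (f : {scalar V}) (u : V) (uh : Vh).
Hypothesis uP : exact_solution a f u.
Hypothesis uhP : discrete_solution ah Eh f uh.

(** The part of the residual on smoothed discrete functions is the consistency
    error of the method. *)
Lemma consistency_residual (Ih : {linear V -> Vh}) :
  bounded_map (fun v : V => `|v|) (norm_h jh) Ih ->
  forall v, a (u - PiV (jh uh)) (Eh (Ih v)) <=
    delta * norm_Ah jh ah * op_norm (fun v : V => `|v|) (norm_h jh) Ih
    * ncf jV jh Ah uh * `|v|.
Proof.
move=> [M IM] v; have [d0 consE] := cons.
have jh_inj : injective jh by case: pair.
rewrite linearBl /= uP -uhP; apply: (le_trans (consE _ _)).
have Iv : `|jh (Ih v)| <= op_norm (fun v : V => `|v|) (norm_h jh) Ih * `|v|.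
  rewrite op_norm_dual.
  apply: (@le_dual_norm_homo _ _ (fun v : V => `|v|) _ _ _ _
    (norm_h jh \o Ih) M) => //.
  - by move=> c x c0; rewrite normrZ ger0_norm.
  - by move=> c x c0; rewrite /= linearZ norm_hZ.
  - by move=> x _; exact: IM.
set nI := op_norm _ _ _ in Iv |- *; set nA := norm_Ah jh ah.
have nA0 : 0 <= nA by exact: (norm_Ah_ge0 ah atE jh_inj).
have AI : dual_norm_h jh (fun x => ah x (Ih v)) <= nA * (nI * `|v|).
  apply: (le_trans (dual_norm_adjoint_le ah atE jh_inj _)).
  by rewrite ler_wpM2l.
have -> : delta * nA * nI * ncf jV jh Ah uh * `|v| =
          delta * (nA * (nI * `|v|)) * ncf jV jh Ah uh by ring.
apply: (@le_trans _ _
  (delta * (nA * (nI * `|v|)) * `|jh uh - jV (PiV (jh uh))|)).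
  by rewrite ler_wpM2r// ler_wpM2l.
rewrite ler_wpM2l ?projection_best// mulr_ge0// mulr_ge0//.
exact: le_trans Iv.
Qed.

Context (Z : finType) (mulPhi : Z -> {linear V -> V}) (Vz Sz : Z -> set V)
  (Ih : {linear V -> Vh}) (Cloc Ccol CL CNL : R)
  (Dz : forall z, set (sum_space (Vz z) (Sz z) -> R^o)).
Hypothesis h2 : hyp2 jh Eh mulPhi Vz Ih Cloc Ccol.
Hypothesis h3 : hyp3 at_ jV jh Dz CL CNL.
Hypothesis f_cont : continuous (f : V -> R).

Let w := u - PiV (jh uh).
Let rho2 := \sum_z dual_norm (fun v : V => `|v|) (Vz z) (a w) ^+ 2.

Lemma reliability B :
  (forall v, a w (Eh (Ih v)) <= B * `|v|) ->
  `|w| ^+ 2 <= 2 * (Cloc ^+ 2 * rho2 + B ^+ 2).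
Proof.
move=> wB; have [Vsub _ [C0 _] part [_ loc]] := h2.
have [partE partV] := part (w - Eh (Ih w)).
apply: (residual_reliable aE Vsub C0 _ partV (loc w) (wB w)).
by rewrite partE subrK.
Qed.

Lemma efficiency : rho2 <= 4 * Ccol ^+ 2 * `|w| ^+ 2.
Proof.
have [Vsub _ [_ C0] _ [col _]] := h2.
exact: (residual_efficient aE Vsub).
Qed.

Let r : {scalar V} :=
  HB.pack (a w : V -> R) (GRing.isLinear.Build R V R *%R (a w) (linearPr a w)).

Let rM v : `|r v| <= `|w| * `|v|.
Proof. exact: cauchy_schwarz_abs. Qed.

Let rE z (y : sum_space (Vz z) (Sz z)) :
  r (\val y) = f (\val y) - res_At at_ jV jh uh y.
Proof.
rewrite -[LHS]/(a w (\val y)) /w linearBl /= uP.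
by rewrite -[res_At _ _ _ _ _]/(at_ (jh uh) (jV (\val y))) dot_projection.
Qed.

Lemma residual_le_estimators :
  rho2 <= 2 * (Defs.eta at_ jV jh Dz f uh ^+ 2 + osc Dz f ^+ 2).
Proof.
have [Vsub _ _ _ _] := h2; have [_ [Ssub Dsub] DA dimSD [DX _]] := h3.
have [M fM] := (continuous_functional_bounded f).1 f_cont.
rewrite /Defs.eta /osc !sqr_sqrtr ?sumr_ge0//; last 2 first.
- by move=> *; exact: sqr_ge0.
- by move=> *; exact: sqr_ge0.
rewrite -big_split mulr_sumr; apply: ler_sum => z _ /=.
have [Dzs Dzd] := Dsub z.
exact: (local_residual_le (Vsub z) (Ssub z) Dzs Dzd (DX z) fM rM (@rE z)
  (DA z uh) (dimSD z)).
Qed.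

Lemma eta_le : Defs.eta at_ jV jh Dz f uh ^+ 2 <= CL ^+ 2 * CNL ^+ 2 * rho2.
Proof.
have [Vsub _ _ _ _] := h2; have [_ [Ssub Dsub] DA dimSD [DX NL]] := h3.
have [M fM] := (continuous_functional_bounded f).1 f_cont.
rewrite /Defs.eta sqr_sqrtr ?sumr_ge0//; last by move=> *; exact: sqr_ge0.
have rc : continuous (r : V -> R).
  by apply/continuous_functional_bounded; exists `|w|; exact: rM.
have := ler_wpM2l (sqr_ge0 CL) (NL r rc); rewrite mulrA.
apply: le_trans; rewrite mulr_sumr; apply: ler_sum => z _ /=.
have [Dzs Dzd] := Dsub z.
exact: (discrete_residual_le (Vsub z) (Ssub z) Dzs Dzd (DX z) fM (@rE z)
  (DA z uh) (dimSD z)).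
Qed.

Lemma osc_le : osc Dz f ^+ 2 <= 2 * (rho2 + Defs.eta at_ jV jh Dz f uh ^+ 2).
Proof.
have [Vsub _ _ _ _] := h2; have [_ [Ssub Dsub] DA dimSD [DX _]] := h3.
have [M fM] := (continuous_functional_bounded f).1 f_cont.
rewrite /Defs.eta /osc !sqr_sqrtr ?sumr_ge0//; last 2 first.
- by move=> *; exact: sqr_ge0.
- by move=> *; exact: sqr_ge0.
rewrite -big_split mulr_sumr; apply: ler_sum => z _ /=.
have [Dzs Dzd] := Dsub z.
exact: (oscillation_le (Vsub z) (Ssub z) Dzs Dzd (DX z) fM rM (@rE z)
  (DA z uh) (dimSD z)).
Qed.

Lemma est_upper C1 C2 : 0 < C1 -> 0 < C2 ->
  `|jV u - jh uh| <=
  Num.sqrt (upper_factor (norm_Ah jh ah)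
    (op_norm (fun v : V => `|v|) (norm_h jh) Ih) Cloc C1 C2) *
  est at_ jV jh Ah Dz delta C1 C2 f uh.
Proof.
move=> C10 C20; have [_ Ib _ _ _] := h2.
have := reliability (consistency_residual Ib).
have := residual_le_estimators; have := projection_best (jh uh) (Ah uh).
rewrite /upper_factor /est -/(ncf jV jh Ah uh).
set k := norm_Ah _ _ * _; set n := ncf _ _ _ _.
set H := _ ^+ 2 + _ ^+ 2; set d := `|_ - _|.
have -> : delta * norm_Ah jh ah * op_norm (fun v : V => `|v|) (norm_h jh) Ih * n
          = delta * k * n by rewrite -(mulrA delta).
have H0 : 0 <= H by rewrite addr_ge0 ?sqr_ge0.
move=> dn rH wB.
set al := 2 * k ^+ 2 / C1 ^+ 2; set be := 4 * Cloc ^+ 2 / C2 ^+ 2.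
have al0 : 0 <= al by rewrite /al; nneg.
have be0 : 0 <= be by rewrite /be; nneg.
have alE : al * C1 ^+ 2 = 2 * k ^+ 2 by rewrite divfK// expf_neq0// gt_eqF.
have beE : be * C2 ^+ 2 = 4 * Cloc ^+ 2 by rewrite divfK// expf_neq0// gt_eqF.
have K0 : 0 <= 1 + al + be by rewrite !addr_ge0.
rewrite -sqrtrM// -[leLHS]ger0_norm// -sqrtr_sqr ler_wsqrtr// pythagoras.
have d2 : d ^+ 2 <= n ^+ 2 by rewrite ler_pXn2r ?nnegrE//; exact: normr_ge0.
have := ler_wpM2l (sqr_ge0 Cloc) rH.
set p := C1 ^+ 2 * delta ^+ 2 * n ^+ 2; set q := C2 ^+ 2 * H.
have p0 : 0 <= p by rewrite /p; nneg.
have q0 : 0 <= q by rewrite /q; nneg.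
have -> : (1 + C1 ^+ 2 * delta ^+ 2) * n ^+ 2 + q = n ^+ 2 + p + q.
  by rewrite /p; ring.
have apE : al * p = 2 * (delta * k * n) ^+ 2.
  transitivity (al * C1 ^+ 2 * (delta ^+ 2 * n ^+ 2)).
    by rewrite /p; ring.
  by rewrite alE; ring.
have bqE : be * q = 4 * Cloc ^+ 2 * H by rewrite /q mulrA beE.
have -> : (1 + al + be) * (n ^+ 2 + p + q) = n ^+ 2 + al * p + be * q +
    (p + q + al * n ^+ 2 + al * q + be * n ^+ 2 + be * p) by ring.
have rest : 0 <= p + q + al * n ^+ 2 + al * q + be * n ^+ 2 + be * p.
  by nneg.
move: wB d2; rewrite apE bqE -/w -/d; lra.
Qed.

Lemma est_lower Cav C1 C2 : av_constant jV jh PiV Ah Cav ->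
  est at_ jV jh Ah Dz delta C1 C2 f uh <=
  Num.sqrt (lower_factor Cav Ccol CL CNL C1 C2 delta) * `|jV u - jh uh|.
Proof.
move=> [Cav0 Cavb]; have := Cavb uh; rewrite -/(ncf jV jh Ah uh).
have := efficiency; have := eta_le; have := osc_le; rewrite /est /lower_factor.
set n := ncf _ _ _ _; set d := `|_ - jV (PiV _)|; set cc := CL ^+ 2 * CNL ^+ 2.
set et := Defs.eta _ _ _ _ _ _ ^+ 2; set os := osc _ _ ^+ 2 => osb etb effb nd.
have cc0 : 0 <= cc by rewrite /cc; nneg.
set l1 := (1 + _) / _; set l2 := C2 ^+ 2 * (_ * (4 * _)).
have C1d : 0 <= 1 + C1 ^+ 2 * delta ^+ 2.
  by nneg.
have l10 : 0 <= l1 by rewrite /l1; nneg.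
have l20 : 0 <= l2.
  by rewrite /l2; nneg.
have <- : Num.sqrt (`|jV u - jh uh| ^+ 2) = `|jV u - jh uh|.
  by rewrite sqrtr_sqr normr_id.
rewrite -sqrtrM ?addr_ge0// ler_wsqrtr//.
rewrite pythagoras -/w -/d (mulrDl l1 l2).
have nd2 : n ^+ 2 <= d ^+ 2 / Cav ^+ 2.
  rewrite ler_pdivlMr ?exprn_gt0// mulrC -exprMn.
  have Cn0 : 0 <= Cav * n by apply: mulr_ge0; [exact: ltW|exact: normr_ge0].
  by rewrite ler_pXn2r ?nnegrE//; exact: normr_ge0.
apply: lerD.
  apply: (@le_trans _ _ (l1 * d ^+ 2)); last first.
    by rewrite ler_wpM2l// lerDr sqr_ge0.
  by rewrite /l1 -(mulrA _ _ (d ^+ 2)) (mulrC _ (d ^+ 2)) ler_wpM2l.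
apply: (@le_trans _ _ (l2 * `|w| ^+ 2)); last first.
  by rewrite ler_wpM2l// lerDl sqr_ge0.
rewrite /l2 -mulrA ler_wpM2l ?sqr_ge0//.
have : (3 * cc + 2) * rho2 <= (3 * cc + 2) * (4 * Ccol ^+ 2 * `|w| ^+ 2).
  by apply: ler_wpM2l => //; nneg.
by rewrite -mulrA => ccb; lra.
Qed.

End NonconformingPair.

(** * Equivalence of error and estimator *)

Theorem theorem3p14 (R : realType) :
  (* arguments: ||| A_h |||, C_av, ||| I_h |||, C_loc, C_col, C_L, C_NL, C_1, C_2;
     the lower constant has delta_h as additional last argument *)
  exists (Clow : R -> R -> R -> R -> R -> R -> R -> R -> R -> R -> R)
         (Cup : R -> R -> R -> R -> R -> R -> R -> R -> R -> R),
  forall (V : completeNormedModType R) (Vh : vectType R) (Vt : normedModType R)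
    (a : {dot V for idfun}) (at_ : {dot Vt for idfun})
    (jV : {linear V -> Vt}) (jh : {linear Vh -> Vt}) (PiV : Vt -> V)
    (ah : {biscalar Vh}) (Eh : {linear Vh -> V}) (delta : R)
    (Ah : {linear Vh -> V}),
  nonconforming_pair a at_ jV jh ->
  orthogonal_projection at_ jV PiV ->
  nondegenerate_form ah ->
  quasi_optimal a jV jh ah Eh ->
  consistency_measure a jV jh PiV ah Eh delta ->
  hyp1 jV jh Ah ->
  (exists Cav : R, av_constant jV jh PiV Ah Cav) /\
  forall (Cav : R)
    (Z : finType) (mulPhi : Z -> {linear V -> V}) (Vz : Z -> set V)
    (Ih : {linear V -> Vh}) (Cloc Ccol : R)
    (Sz : Z -> set V) (Dz : forall z, set (sum_space (Vz z) (Sz z) -> R^o))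
    (CL CNL C1 C2 : R),
  av_constant jV jh PiV Ah Cav ->
  hyp2 jh Eh mulPhi Vz Ih Cloc Ccol ->
  hyp3 at_ jV jh Dz CL CNL ->
  0 < C1 -> 0 < C2 ->
  let nA := norm_Ah jh ah in
  let nI := op_norm (fun v : V => `|v|) (norm_h jh) Ih in
  let cl := Clow nA Cav nI Cloc Ccol CL CNL C1 C2 delta in
  let cu := Cup nA Cav nI Cloc Ccol CL CNL C1 C2 in
  0 < cl /\ 0 < cu /\
  forall (f : {scalar V}) (u : V) (uh : Vh),
    continuous (f : V -> R) ->
    exact_solution a f u ->
    discrete_solution ah Eh f uh ->
    cl * est at_ jV jh Ah Dz delta C1 C2 f uh <= `|jV u - jh uh| <=
    cu * est at_ jV jh Ah Dz delta C1 C2 f uh.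
Proof.
exists (fun _ Cav _ _ Ccol CL CNL C1 C2 delta =>
  (Num.sqrt (lower_factor Cav Ccol CL CNL C1 C2 delta))^-1).
exists (fun nA _ nI Cloc _ _ _ C1 C2 =>
  Num.sqrt (upper_factor nA nI Cloc C1 C2)).
move=> V Vh Vt a at_ jV jh PiV ah Eh delta Ah pair proj _ _ cons h1.
split; first exact: (av_constant_exists pair proj h1).
move=> Cav Z mulPhi Vz Ih Cloc Ccol Sz Dz CL CNL C1 C2 av h2 h3 C10 C20.
move=> nA nI cl cu.
have cl0 : 0 < cl.
  rewrite invr_gt0 sqrtr_gt0 /lower_factor ltr_pwDl//.
    have [Cav0 _] := av; rewrite divr_gt0 ?exprn_gt0//.
    by apply: ltr_pwDl => //; nneg.
  by nneg.
split=> //; split.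
  by rewrite sqrtr_gt0 /upper_factor -addrA ltr_pwDl//; nneg.
move=> f u uh f_cont uP uhP; apply/andP; split; last first.
  exact: (est_upper pair proj Ah cons uP uhP h2 h3 f_cont C10 C20).
move: cl0; rewrite /cl invr_gt0 => s0; rewrite ler_pdivrMl//.
exact: (est_lower pair proj _ _ uP h2 h3 f_cont C1 C2 av).
Qed.
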